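(* Let $\mathbb{P}$ be a probability measure on $\Xi\subseteq\mathbb{R}^p$, $p\ne2$, for which there is $a>1$ with $A:=\mathbb{E}_{\mathbb{P}}[\exp(\|\xi\|^a)]<\infty$, and consider the stochastic coalitional game $G_{\mathbb{P}}=\{\mathcal{N},\{u_S\}_{S\subseteq\mathcal{N}},\Xi,\mathbb{P}\}$. Assume that for each $S\subset\mathcal{N}$ there is $L_S\ge0$ with $|u_S(\xi)-u_S(\xi')|\le L_S\|\xi-\xi'\|$ for all $\xi,\xi'\in\Xi$. Suppose that for each $S\subset\mathcal{N}$ the confidence parameters $\beta_S^{K_S}\in(0,1)$, $K_S\in\mathbb{N}$, satisfy $\sum_{K_S=1}^\infty\beta_S^{K_S}<\infty$ and $\lim_{K_S\to\infty}\epsilon_S(\beta_S^{K_S},K_S)=0$, where $$\epsilon_S(\beta,k)=\begin{cases}\left(\dfrac{\ln(c/\beta)}{qk}\right)^{1/\max\{p,2\}}, & k\ge\dfrac{\ln(c/\beta)}{q},\\[2mm] \left(\dfrac{\ln(c/\beta)}{qk}\right)^{1/a}, & k<\dfrac{\ln(c/\beta)}{q},\end{cases}$$ with $c,q>0$ the constants described in the context. For $K=(K_S)_{S\subset\mathcal{N}}\in\mathbb{N}^M$ let $C_{\mathrm{DR}}(G_{\hat{\mathcal{P}}_K})$ be the DR core with ambiguity sets $\hat{\mathcal{P}}_{K_S}=\mathbb{B}_{\epsilon_S(\beta_S^{K_S},K_S)}(\hat{\mathbb{P}}_{K_S})$. Then any sequence of the Wasserstein-based DR cores $\{C_{\mathrm{DR}}(G_{\hat{\mathcal{P}}_K})\}_{K\in\mathbb{N}^M}$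 converges $\mathbb{P}^\infty$-almost surely to the true expected value core $C_E(G_{\mathbb{P}})$ as $K_S\to\infty$ for all $S\subset\mathcal{N}$.
   Context: Agents: $\mathcal{N}=\{1,\dots,N\}$. $S\subset\mathcal{N}$ means a proper subset (a subcoalition); there are $M=2^N-1$ of them. The uncertainty $\xi$ takes values in $\Xi\subseteq\mathbb{R}^p$. Each subcoalition $S$ has a value function $u_S:\Xi\to\mathbb{R}$ (stochastic, through $\xi$); the grand coalition's value $u_{\mathcal{N}}\in\mathbb{R}$ is deterministic. Expected value core: $$C_E(G_{\mathbb{P}})=\Big\{x\in\mathbb{R}^N:\ \sum_{i\in\mathcal{N}}x_i=u_{\mathcal{N}},\ \sum_{i\in S}x_i\ge\mathbb{E}_{\mathbb{P}}[u_S(\xi)]\ \ \forall S\subset\mathcal{N}\Big\}.$$ $\mathcal{M}(\Xi)$ is the set of probability distributions $\mathbb{Q}$ supported on $\Xi$ with $\int_\Xi\|\xi\|\,\mathbb{Q}(d\xi)<\infty$, where $\|\cdot\|$ is a fixed norm on $\mathbb{R}^p$; $\mathbb{P}\in\mathcal{M}(\Xi)$. The Wasserstein distance is $d_W(\mathbb{Q}_1,\mathbb{Q}_2)=\inf_\Pi\int_{\Xi^2}\|\xi_1-\xi_2\|\,\Pi(d\xi_1,d\xi_2)$, the infimum being over joint distributions $\Pi$ with marginals $\mathbb{Q}_1,\mathbb{Q}_2$. Each coalition $S\subset\mathcal{N}$ has its own i.i.d. samples $\xi^{(1)},\xi^{(2)},\dots$ from $\mathbb{P}$, independent across coalitions;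 $\mathbb{P}^\infty$ denotes the resulting (product) law of all samples. $\hat{\mathbb{P}}_{K_S}$ is the empirical distribution placing mass $1/K_S$ on each of the samples $\xi^{(1)},\dots,\xi^{(K_S)}$ of coalition $S$, and $\mathbb{B}_{\epsilon}(\hat{\mathbb{P}}_{K_S})=\{\mathbb{Q}_S\in\mathcal{M}(\Xi):\ d_W(\hat{\mathbb{P}}_{K_S},\mathbb{Q}_S)\le\epsilon\}$. Distributionally robust (DR) core: $$C_{\mathrm{DR}}(G_{\hat{\mathcal{P}}_K})=\Big\{x\in\mathbb{R}^N:\ \sum_{i\in\mathcal{N}}x_i=u_{\mathcal{N}},\ \sum_{i\in S}x_i\ge\sup_{\mathbb{Q}_S\in\hat{\mathcal{P}}_{K_S}}\mathbb{E}_{\mathbb{Q}_S}[u_S(\xi)]\ \ \forall S\subset\mathcal{N}\Big\}.$$ Standing assumption: for all multi-samples the ambiguity sets are such that the DR core is non-empty. Constants: $c,q>0$ are constants depending only on $a$, $A$ and $p$ for which the (known) Wasserstein measure concentration inequality holds: for every $\epsilon>0$ and every integer $k\ge1$, if $\hat{\mathbb{P}}_k$ is the empirical distribution of $k$ i.i.d. samples from $\mathbb{P}$, then $\mathbb{P}^{k}\{d_W(\mathbb{P},\hat{\mathbb{P}}_k)\le\epsilon\}\ge 1-b(\epsilon,k)$, where $b(\epsilon,k)=c\exp(-qk\epsilon^{\max\{p,2\}})$ if $\epsilon\le1$ and $b(\epsilon,k)=c\exp(-qk\epsilon^{a})$ if $\epsilon>1$. The radius $\epsilon_S(\beta,k)$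 is obtained by solving $b(\epsilon,k)=\beta$ for $\epsilon$. The source states the convergence of the sets without specifying a mode of set convergence. *)

(* Defs.v *)
From HB Require Import structures.
From mathcomp Require Import all_boot all_order all_algebra.
From mathcomp Require Import all_classical all_reals all_analysis.

Set Implicit Arguments.
Unset Strict Implicit.
Unset Printing Implicit Defensive.
Import Order.TTheory GRing.Theory Num.Theory.
Import numFieldNormedType.Exports.

Local Open Scope classical_set_scope.
Local Open Scope ring_scope.

Record is_norm (R : realType) (p : nat) (nrm : 'rV[R]_p -> R) : Prop := IsNorm {
  is_norm_triangle : forall x y, nrm (x + y) <= nrm x + nrm y ;
  is_norm_homogeneous : forall (l : R) x, nrm (l *: x) = `|l| * nrm x ;
  is_norm_definite : forall x, nrm x = 0 -> x = 0 }.

Definition borel_rV (R : realType) (p : nat) : Type :=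
  g_sigma_algebraType (@open 'rV[R]_p).
HB.instance Definition _ (R : realType) (p : nat) :=
  Measurable.on (borel_rV R p).

(* The set Xi as a measurable space, with the trace of the Borel
   sigma-algebra; Xi itself need not be Borel. Measurable types are pointed,
   hence the argument [Xi0], which is implied by the existence of a
   probability measure on Xi. *)
Section outcome.
Context (R : realType) (p : nat) (Xi : set 'rV[R]_p).

Definition outcome (Xi0 : Xi !=set0) : Type := set_type Xi.

Context (Xi0 : Xi !=set0).

HB.instance Definition _ := Choice.on (outcome Xi0).
HB.instance Definition _ := @isPointed.Build (outcome Xi0)
  (SigSub (mem_set (svalP (cid Xi0)))).

Definition outcome_val (x : outcome Xi0) : borel_rV R p := set_val x.

HB.instance Definition _ := Measurable.copy (outcome Xi0)
  (g_sigma_algebra_preimageType outcome_val).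

End outcome.

Section wasserstein.
Context (R : realType) (p : nat) (Xi : set 'rV[R]_p) (Xi0 : Xi !=set0).
Context (nrm : 'rV[R]_p -> R).
Let T := outcome Xi0.

Definition onorm (x : T) : R := nrm (set_val x).
Definition odist (x y : T) : R := nrm (set_val x - set_val y).

Definition finite_first_moment (Q : probability T R) : Prop :=
  (\int[Q]_x (onorm x)%:E < +oo)%E.

Definition coupling (Q1 Q2 : {measure set T -> \bar R})
    (Pi : probability (T * T)%type R) : Prop :=
  forall A : set T, measurable A ->
    Pi (A `*` [set: T]) = Q1 A /\ Pi ([set: T] `*` A) = Q2 A.

Definition wasserstein (Q1 Q2 : {measure set T -> \bar R}) : \bar R :=
  ereal_inf [set (\int[Pi]_z (odist z.1 z.2)%:E)%E | Pi in coupling Q1 Q2].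

(* Mass 1/k on each of x 0, ..., x k.-1; meaningful for 0 < k only. *)
Definition empirical (x : nat -> T) (k : nat) : {measure set T -> \bar R} :=
  mscale (k%:R^-1 : R)%:nng (msum (fun i => \d_(x i)) k).

Definition wasserstein_ball (mu : {measure set T -> \bar R}) (eps : R) :
    set (probability T R) :=
  [set Q | finite_first_moment Q /\ (wasserstein mu Q <= eps%:E)%E].

End wasserstein.
Arguments empirical {R p Xi Xi0} x k.

Section iid.
Context (R : realType) (d d' : measure_display).
Context (Om : measurableType d) (T : measurableType d').

Definition mutually_independent (Pr : probability Om R) (I : eqType)
    (X : I -> Om -> T) : Prop :=
  forall (s : seq I) (A : I -> set T), uniq s ->
    (forall i, measurable (A i)) ->
    Pr (\big[setI/setT]_(i <- s) (X i @^-1` A i)) =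
    (\prod_(i <- s) Pr (X i @^-1` A i))%E.

Definition iid (Pr : probability Om R) (P : probability T R) (I : eqType)
    (X : I -> Om -> T) : Prop :=
  [/\ forall i, measurable_fun [set: Om] (X i),
      forall i (A : set T), measurable A -> Pr (X i @^-1` A) = P A &
      mutually_independent Pr X].

(* "A has probability at least r", without having to show first that A is
   measurable, in the same way as {ae Pr, _} does not require it. *)
Definition prob_ge (Pr : probability Om R) (A : set Om) (r : R) : Prop :=
  exists B : set Om, [/\ measurable B, B `<=` A & (r%:E <= Pr B)%E].

Lemma prob_geE (Pr : probability Om R) (A : set Om) (r : R) :
  measurable A -> prob_ge Pr A r <-> (r%:E <= Pr A)%E.
Proof.
move=> mA; split=> [[B [mB BA rB]]|rA]; last by exists A; split.
by apply: (le_trans rB); apply: le_measure => //; exact: mem_set.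
Qed.

End iid.

Section concentration.
Context (R : realType) (p : nat).

Definition conc_bound (a c q eps : R) (k : nat) : R :=
  if eps <= 1 then c * expR (- (q * k%:R * eps `^ (maxn p 2)%:R))
  else c * expR (- (q * k%:R * eps `^ a)).

(* The solution eps of conc_bound a c q eps k = beta. The library's real power
   of a negative base is 1: this value is only reached when c < beta. *)
Definition eps_radius (a c q beta : R) (k : nat) : R :=
  if ln (c / beta) / q <= k%:R
  then (ln (c / beta) / (q * k%:R)) `^ (maxn p 2)%:R^-1
  else (ln (c / beta) / (q * k%:R)) `^ a^-1.

Definition concentration (nrm : 'rV[R]_p -> R) (Xi : set 'rV[R]_p)
    (Xi0 : Xi !=set0) (P : probability (outcome Xi0) R) (a c q : R) : Prop :=
  forall (eps : R) (k : nat), 0 < eps -> (0 < k)%N ->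
  forall (d : measure_display) (Om : measurableType d) (Pr : probability Om R)
    (X : nat -> Om -> outcome Xi0),
    iid Pr P (fun i : 'I_k => X i) ->
    prob_ge Pr
      [set w | (wasserstein nrm P (empirical (X ^~ w) k) <= eps%:E)%E]
      (1 - conc_bound a c q eps k).

End concentration.

(* The proper subsets of the set of agents, including the empty one: there
   are 2 ^ N - 1 of them. *)
Definition subcoalition (N : nat) : Type :=
  {S : {set 'I_N} | S \proper [set: 'I_N]%SET}.
HB.instance Definition _ (N : nat) := Finite.on (subcoalition N).

Section cores.
Context (R : realType) (N : nat) (d : measure_display) (T : measurableType d).
Context (uN : R) (u : subcoalition N -> T -> R).

Definition payoff (x : 'rV[R]_N) (S : {set 'I_N}) : R := \sum_(i in S) x 0 i.

Definition E_core (P : probability T R) : set 'rV[R]_N :=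
  [set x : 'rV[R]_N | \sum_i x 0 i = uN /\
    forall S : subcoalition N, ('E_P[u S] <= (payoff x (sval S))%:E)%E].

Definition DR_core (amb : subcoalition N -> set (probability T R)) :
    set 'rV[R]_N :=
  [set x : 'rV[R]_N | \sum_i x 0 i = uN /\
    forall S : subcoalition N,
      (ereal_sup [set 'E_Q[u S] | Q in amb S] <= (payoff x (sval S))%:E)%E].

End cores.

(* The ambiguity sets of all subcoalitions, for a multi-sample xi (the (i+1)-th
   sample of S is xi (S, i)) and sample sizes K. *)
Definition wasserstein_ambiguity (R : realType) (p : nat) (Xi : set 'rV[R]_p)
    (Xi0 : Xi !=set0) (nrm : 'rV[R]_p -> R) (N : nat) (a c q : R)
    (beta : subcoalition N -> nat -> R)
    (xi : subcoalition N * nat -> outcome Xi0) (K : subcoalition N -> nat)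
    (S : subcoalition N) : set (probability (outcome Xi0) R) :=
  wasserstein_ball nrm (empirical (fun i => xi (S, i)) (K S))
    (eps_radius p a c q (beta S (K S)) (K S)).

Section hausdorff.
Context (R : realType) (V : normedModType R).
Local Open Scope ereal_scope.

Definition excess (A B : set V) : \bar R :=
  ereal_sup [set ereal_inf [set `|x - y|%:E | y in B] | x in A].

Definition hausdorff_dist (A B : set V) : \bar R :=
  maxe (excess A B) (excess B A).

End hausdorff.

(* Main.v *)
From HB Require Import structures.
Require Import Defs.
From mathcomp Require Import all_boot all_order all_algebra.
From mathcomp Require Import all_classical all_reals all_analysis.
From mathcomp Require Import measurable_realfun ring lra.
Set Implicit Arguments.
Unset Strict Implicit.
Unset Printing Implicit Defensive.
Import Order.TTheory GRing.Theory Num.Theory.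
Import numFieldNormedType.Exports.
Local Open Scope classical_set_scope.
Local Open Scope ring_scope.

(** The radius is chosen so that, by the concentration inequality, P leaves the
    ball around the k-th empirical distribution with probability at most
    beta_k once beta_k < c; the beta_k being summable, Borel-Cantelli puts P in
    all but finitely many balls almost surely. By the coupling bound
    |E_Q u - E_P u| <= L d_W(Q, P), the worst-case expectations w_S(k) are then
    squeezed between v_S = E_P u_S and v_S + 2 L_S eps_S(k). What remains is
    deterministic: the DR cores lie in the bounded expected value core, and
    moving any point of the latter slightly towards one fixed point, picked in
    a suitable DR core, makes it satisfy the perturbed constraints. *)

(** * Arbitrary norms on row vectors, controlled by coordinates *)

Section norms.
Context (R : realType) (p : nat) (nrm : 'rV[R]_p -> R).
Hypothesis nrm_norm : is_norm nrm.
Implicit Types (x y z : 'rV[R]_p) (e r : R).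

Lemma is_norm0 : nrm 0 = 0.
Proof. by rewrite -(scale0r 0) (is_norm_homogeneous nrm_norm) normr0 mul0r. Qed.

Lemma is_normN x : nrm (- x) = nrm x.
Proof.
by rewrite -scaleN1r (is_norm_homogeneous nrm_norm) normrN normr1 mul1r.
Qed.

Lemma is_norm_ge0 x : 0 <= nrm x.
Proof.
have := is_norm_triangle nrm_norm x (- x).
by rewrite subrr is_norm0 is_normN; lra.
Qed.

Lemma is_norm_distC x y : nrm (x - y) = nrm (y - x).
Proof. by rewrite -opprB is_normN. Qed.

Lemma is_norm_distD z x y : nrm (x - y) <= nrm (x - z) + nrm (z - y).
Proof. by rewrite -(subrKA z) (is_norm_triangle nrm_norm). Qed.

Lemma is_norm_sum (I : Type) (s : seq I) (f : I -> 'rV[R]_p) :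
  nrm (\sum_(i <- s) f i) <= \sum_(i <- s) nrm (f i).
Proof.
elim/big_ind2 : _ => [|x1 x2 y1 y2 h1 h2|//]; first by rewrite is_norm0.
exact: le_trans (is_norm_triangle nrm_norm _ _) (lerD h1 h2).
Qed.

(** Expand [x] in the standard basis. This makes [nrm] continuous for the ambient topology, which is
    that of the largest coordinate. *)
Lemma is_norm_le_coord x e : (forall i, `|x 0 i| <= e) ->
  nrm x <= e * \sum_i nrm (delta_mx 0 i).
Proof.
move=> xe; rewrite [x in leLHS]row_sum_delta mulr_sumr.
apply: le_trans (is_norm_sum _ _) _; apply: ler_sum => i _.
by rewrite (is_norm_homogeneous nrm_norm) ler_wpM2r// is_norm_ge0.
Qed.

Lemma is_norm_coord_small e : 0 < e ->
  exists2 r, 0 < r & forall x, (forall i, `|x 0 i| <= r) -> nrm x < e.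
Proof.
move=> e0; set C := \sum_i nrm (delta_mx 0 i : 'rV[R]_p).
have C0 : 0 <= C by apply: sumr_ge0 => i _; exact: is_norm_ge0.
exists (e / (C + 1)); first by rewrite divr_gt0// ltr_wpDl.
move=> x /is_norm_le_coord /le_lt_trans; apply; rewrite -/C.
by rewrite mulrAC ltr_pdivrMr ?ltr_wpDl// ltr_pM2l// ltrDl.
Qed.

Lemma open_is_norm_ball (y : 'rV[R]_p) r : open [set x | nrm (x - y) < r].
Proof.
rewrite openE => x /= xr.
have e0 : 0 < r - nrm (x - y) by rewrite subr_gt0.
have [d d0 dP] := is_norm_coord_small e0.
apply/nbhs_ballP; exists d => //= z [_ xz] /=.
apply: le_lt_trans (is_norm_distD x z y) _.
rewrite -ltrBrDr is_norm_distC; apply: dP => i.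
by rewrite !mxE; apply/ltW; exact: xz.
Qed.

Lemma rat_row_dense (y : 'rV[R]_p) e : 0 < e ->
  exists q : 'rV[rat]_p, nrm (map_mx ratr q - y) < e.
Proof.
move=> /is_norm_coord_small[r r0 rP].
have h i : exists q : rat, ratr q \in `]y 0 i, (y 0 i + r)[.
  by have [|q] := @rat_in_itvoo R (y 0 i) (y 0 i + r); [by rewrite ltrDl|exists q].
exists (\row_i xchoose (h i)); apply: rP => i; rewrite !mxE.
have := xchooseP (h i); rewrite in_itv/= => /andP[h1 h2].
by rewrite ler_norml; apply/andP; split; lra.
Qed.

End norms.

(** * Measurability on the outcome space *)

Section outcome_measurability.
Context (R : realType) (p : nat) (Xi : set 'rV[R]_p) (Xi0 : Xi !=set0).
Context (nrm : 'rV[R]_p -> R).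
Hypothesis nrm_norm : is_norm nrm.
Local Notation T := (outcome Xi0).

Lemma odistC (x y : T) : odist nrm x y = odist nrm y x.
Proof. exact: is_norm_distC. Qed.

Lemma onorm_ge0 (x : T) : 0 <= onorm nrm x.
Proof. exact: is_norm_ge0. Qed.

Lemma odist_ge0 (x y : T) : 0 <= odist nrm x y.
Proof. exact: is_norm_ge0. Qed.

Lemma measurable_preimage_open (U : set 'rV[R]_p) : open U ->
  measurable ((fun x : T => set_val x) @^-1` U).
Proof.
move=> oU; exists U; first exact: sub_sigma_algebra.
by rewrite setTI.
Qed.

Lemma measurable_fun_lt_fun d (X : measurableType d) (f : X -> R) :
  (forall r, measurable [set x | f x < r]) -> measurable_fun setT f.
Proof.
move=> mf; apply: (measurability _ (RGenInftyO.measurableE R)) => A.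
move=> [B [r ->] <-]; rewrite setTI.
by have -> : f @^-1` `]-oo, r[ = [set x | f x < r]
  by apply/seteqP; split => x /=; rewrite in_itv.
Qed.

Lemma measurable_fun_dist_point (y : 'rV[R]_p) :
  measurable_fun [set: T] (fun x : T => nrm (set_val x - y)).
Proof.
apply: measurable_fun_lt_fun => r.
have : measurable ((fun x : T => set_val x) @^-1` [set z | nrm (z - y) < r]).
  apply: measurable_preimage_open; exact: open_is_norm_ball.
exact.
Qed.

Lemma measurable_onorm : measurable_fun [set: T] (onorm nrm).
Proof.
have := measurable_fun_dist_point 0.
by under eq_fun do rewrite subr0.
Qed.

(** As [f] lives on [Xi] only, each strict sublevel set is exhibited as the trace of an open set
    [U], a union of balls around its points. The radius is small enough for the Lipschitz bound to
    keep [f] below [r]; dividing by [L + 1] covers [L = 0]. *)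
Lemma lipschitz_measurable (f : T -> R) (L : R) : 0 <= L ->
  (forall x y, `|f x - f y| <= L * odist nrm x y) ->
  measurable_fun [set: T] f.
Proof.
move=> L0 fL; apply: measurable_fun_lt_fun => r.
pose U := \bigcup_(x in [set x : T | f x < r])
  [set z : 'rV[R]_p | nrm (z - set_val x) < (r - f x) / (L + 1)].
have L1 : 0 < L + 1 by rewrite ltr_wpDl.
have -> : [set x | f x < r] = (fun x : T => set_val x) @^-1` U.
  apply/seteqP; split => x /=.
    by move=> fxr; exists x => //=; rewrite subrr is_norm0// divr_gt0// subr_gt0.
  move=> [y /= fyr]; rewrite ltr_pdivlMr// => xy.
  have := fL x y; rewrite /odist; have := is_norm_ge0 nrm_norm (set_val x - set_val y).
  rewrite ler_norml => D0 /andP[_ h].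
  have : L * nrm (set_val x - set_val y) <=
      nrm (set_val x - set_val y) * (L + 1) by rewrite mulrDr mulr1 mulrC lerDl.
  by lra.
apply: measurable_preimage_open; apply: bigcup_open => x _.
exact: open_is_norm_ball.
Qed.

(** The product sigma-algebra sees the two coordinates separately, so the distance is split through
    a rational point [q]: it is below [r] iff the distances to some [q] add up to less than [r].
    This is a countable union. *)
Lemma measurable_odist :
  measurable_fun [set: T * T] (fun z : T * T => odist nrm z.1 z.2).
Proof.
apply: measurable_fun_lt_fun => r.
pose D (q : 'rV[rat]_p) (x : T) : R := nrm (set_val x - map_mx ratr q).
pose F (q : 'rV[rat]_p) := [set z : T * T | D q z.1 + D q z.2 < r].
have -> : [set z : T * T | odist nrm z.1 z.2 < r] = \bigcup_q F q.
  apply/seteqP; split => [[x y]|[x y] [q _]] /=; last first.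
    apply: le_lt_trans; rewrite /odist /D.
    rewrite (is_norm_distC nrm_norm (set_val y)).
    exact: is_norm_distD.
  rewrite /odist => xyr.
  (* Half the gap, since the distance from [q] to [y] is paid twice. *)
  have e0 : 0 < (r - nrm (set_val x - set_val y)) / 2.
    by rewrite divr_gt0// subr_gt0.
  have [q qe] := rat_row_dense nrm_norm (set_val y) e0.
  exists q => //=; rewrite /F /D/=.
  have := is_norm_distD nrm_norm (set_val y) (set_val x) (map_mx ratr q).
  by move: qe; rewrite (is_norm_distC nrm_norm (map_mx _ _)); lra.
apply: countable_bigcupT_measurable => [|q]; first exact: countableP.
have -> : F q = setT `&` (fun z : T * T => D q z.1 + D q z.2) @^-1` `]-oo, r[.
  by rewrite setTI; apply/seteqP; split => z /=; rewrite in_itv.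
apply: (measurable_funD (D := setT)) => //.
- exact: measurableT_comp (measurable_fun_dist_point _) measurable_fst.
- exact: measurableT_comp (measurable_fun_dist_point _) measurable_snd.
Qed.

End outcome_measurability.

(** * Change of variables along a measurable map *)

Section image_measure.
Context d1 d2 (X : measurableType d1) (Y : measurableType d2) (R : realType).
Context (phi : X -> Y) (mu : {measure set X -> \bar R}).
Context (nu : {measure set Y -> \bar R}).
Hypothesis mphi : measurable_fun [set: X] phi.
Hypothesis nuE : forall A, measurable A -> nu A = mu (phi @^-1` A).
Local Open Scope ereal_scope.

(** Agreement of [nu] with the image measure is asked on measurable sets, the form in which a
    coupling provides its marginals. *)
Lemma ge0_integral_image (f : Y -> \bar R) : measurable_fun setT f ->
  (forall y, 0 <= f y) -> \int[nu]_y f y = \int[mu]_x f (phi x).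
Proof.
move=> mf f0; rewrite -[RHS]/(\int[mu]_(x in phi @^-1` setT) (f \o phi) x).
rewrite -(ge0_integral_pushforward mphi)//.
by apply: eq_measure_integral => A mA _; exact: nuE.
Qed.

Lemma integrable_image (f : Y -> \bar R) : measurable_fun setT f ->
  nu.-integrable setT f <-> mu.-integrable setT (f \o phi).
Proof.
move=> mf; have E : \int[nu]_y `|f y| = \int[mu]_x `|f (phi x)|.
  by apply: ge0_integral_image => //; exact: measurableT_comp.
split => /integrableP[_ h]; apply/integrableP; split => //.
- exact: measurableT_comp.
- by rewrite -E.
- by rewrite E.
Qed.

Lemma integral_image (f : Y -> \bar R) : measurable_fun setT f ->
  nu.-integrable setT f -> \int[nu]_y f y = \int[mu]_x f (phi x).
Proof.
move=> mf /(integrable_image mf) fi.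
rewrite -[RHS]/(\int[mu]_(x in phi @^-1` setT) (f \o phi) x).
rewrite -(integral_pushforward mphi)//.
by apply: eq_measure_integral => A mA _; exact: nuE.
Qed.

End image_measure.

(** * Wasserstein distance: symmetry and Lipschitz test functions *)

Section wasserstein_theory.
Context (R : realType) (p : nat) (Xi : set 'rV[R]_p) (Xi0 : Xi !=set0).
Context (nrm : 'rV[R]_p -> R).
Hypothesis nrm_norm : is_norm nrm.
Local Notation T := (outcome Xi0).
Implicit Type Q : {measure set T -> \bar R}.
Implicit Type Pi : probability (T * T)%type R.
Local Open Scope ereal_scope.

Lemma coupling_fst Q Q' Pi : coupling Q Q' Pi ->
  forall A : set T, measurable A -> Q A = Pi (fst @^-1` A).
Proof.
move=> c A mA; have [<- _] := c A mA.
by congr (Pi _); apply/seteqP; split => z /=; tauto.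
Qed.

Lemma coupling_snd Q Q' Pi : coupling Q Q' Pi ->
  forall A : set T, measurable A -> Q' A = Pi (snd @^-1` A).
Proof.
move=> c A mA; have [_ <-] := c A mA.
by congr (Pi _); apply/seteqP; split => z /=; tauto.
Qed.

Let swap_mfun : {mfun (T * T)%type >-> (T * T)%type} :=
  HB.pack (@unstable.swap T T)
    (isMeasurableFun.Build _ _ _ _ _ (@measurable_swap _ _ T T)).

(** Exchanging the two coordinates turns a coupling into one of the reversed pair, at the same
    cost. *)
Lemma wasserstein_sym_le Q Q' : wasserstein nrm Q Q' <= wasserstein nrm Q' Q.
Proof.
apply: le_ereal_inf_tmp => _ [Pi c <-].
apply: ereal_inf_lbound; exists (distribution Pi swap_mfun).
  move=> A mA; have [h1 h2] := c A mA; rewrite -h1 -h2; split.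
    by congr (Pi _); apply/seteqP; split => -[x y] /=; tauto.
  by congr (Pi _); apply/seteqP; split => -[x y] /=; tauto.
rewrite (@ge0_integral_image _ _ _ _ _ (@unstable.swap T T) Pi) //.
- by apply: eq_integral => -[x y] _ /=; rewrite odistC.
- exact: measurable_swap.
- by apply/measurable_EFinP; exact: measurable_odist.
- by move=> z; rewrite lee_fin odist_ge0.
Qed.

Lemma wasserstein_sym Q Q' : wasserstein nrm Q Q' = wasserstein nrm Q' Q.
Proof. by apply/eqP; rewrite eq_le !wasserstein_sym_le. Qed.

Section lipschitz.
Context (f : T -> R) (L : R).
Hypothesis L0 : (0 <= L)%R.
Hypothesis fL : forall x y, (`|f x - f y| <= L * odist nrm x y)%R.

(** The easy half of Kantorovich-Rubinstein duality. Under [Pi], [f z.1] is dominated by [|f z.2|]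
    plus [L] times the distance, which transfers integrability from [Q'] to [Q]; both integrals then
    become integrals against [Pi] and are subtracted pointwise. *)
Lemma coupling_lipschitz Q Q' Pi r : coupling Q Q' Pi ->
  \int[Pi]_z (odist nrm z.1 z.2)%:E <= r%:E ->
  Q'.-integrable setT (EFin \o f) ->
  Q.-integrable setT (EFin \o f) /\
  `|\int[Q]_x (f x)%:E - \int[Q']_x (f x)%:E| <= (L * r)%:E.
Proof.
move=> c Dr f2.
have mf : measurable_fun setT f := lipschitz_measurable nrm_norm L0 fL.
have mfE : measurable_fun setT (EFin \o f) by exact/measurable_EFinP.
have mD := measurable_odist (Xi0 := Xi0) nrm_norm.
have D0 (z : T * T) : 0 <= (odist nrm z.1 z.2)%:E by rewrite lee_fin odist_ge0.
have mDE : measurable_fun setT (fun z : T * T => (odist nrm z.1 z.2)%:E).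
  exact/measurable_EFinP.
have Di : Pi.-integrable setT (fun z => (odist nrm z.1 z.2)%:E).
  apply/integrableP; split => //.
  under eq_integral do rewrite gee0_abs//.
  exact: le_lt_trans (ltry r).
have LDi : Pi.-integrable setT (fun z => L%:E * (odist nrm z.1 z.2)%:E).
  exact: integrableZl.
have g2 : Pi.-integrable setT ((EFin \o f) \o snd).
  by apply/(integrable_image measurable_snd (coupling_snd c)).
have g1 : Pi.-integrable setT ((EFin \o f) \o fst).
  apply: (@le_integrable _ _ _ Pi setT measurableT _
    (fun z => `|f z.2|%:E + L%:E * (odist nrm z.1 z.2)%:E)) => //.
  - exact: measurableT_comp.
  - move=> z _; rewrite -EFinM -EFinD !abse_EFin lee_fin.
    rewrite (le_trans _ (ler_norm _))//.
    have := fL z.1 z.2; have := ler_normD (f z.1 - f z.2)%R (f z.2).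
    by rewrite subrK; lra.
  - by apply: integrableD => //; exact: (integrable_abse g2).
have f1 : Q.-integrable setT (EFin \o f).
  by apply/(integrable_image measurable_fst (coupling_fst c)).
split=> //.
rewrite (integral_image measurable_fst (coupling_fst c) mfE f1).
rewrite (integral_image measurable_snd (coupling_snd c) mfE f2).
rewrite -(integralB (D := setT))//.
apply: le_trans (le_abse_integral _ _ _) _ => //.
  by apply: emeasurable_funB; exact: measurableT_comp.
apply: le_trans (_ : \int[Pi]_z (L%:E * (odist nrm z.1 z.2)%:E) <= _).
  apply: ge0_le_integral => //.
  - by apply: measurableT_comp => //; apply: emeasurable_funB; exact: measurableT_comp.
  - by apply/measurable_EFinP; exact: measurable_funM.
  - by move=> z _; rewrite -EFinB abse_EFin -EFinM lee_fin.
by rewrite ge0_integralZl// EFinM lee_wpmul2l.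
Qed.

Lemma wasserstein_lipschitz Q Q' r : wasserstein nrm Q Q' <= r%:E ->
  Q'.-integrable setT (EFin \o f) ->
  Q.-integrable setT (EFin \o f) /\
  `|\int[Q]_x (f x)%:E - \int[Q']_x (f x)%:E| <= (L * r)%:E.
Proof.
move=> Wr f2.
(* No optimal coupling is at hand: take one of cost below [r + e], then let [e] tend to 0. *)
have h e : (0 < e)%R -> Q.-integrable setT (EFin \o f) /\
    `|\int[Q]_x (f x)%:E - \int[Q']_x (f x)%:E| <= (L * (r + e))%:E.
  move=> e0.
  have /ereal_inf_lt[_ [Pi c <-] /ltW Pir] : wasserstein nrm Q Q' < (r + e)%:E.
    by apply: le_lt_trans Wr _; rewrite lte_fin ltrDl.
  exact: coupling_lipschitz c Pir f2.
split; first by have [] := h _ ltr01.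
apply/lee_addgt0Pr => e e0.
have L1 : (0 < L + 1)%R by rewrite ltr_wpDl.
have [_ /le_trans] := h (e / (L + 1))%R (divr_gt0 e0 L1); apply.
rewrite -EFinD lee_fin mulrDr lerD2l mulrCA ger_pMr// ler_pdivrMr// mul1r.
by rewrite lerDl.
Qed.

End lipschitz.

End wasserstein_theory.

(** * The radius inverts the concentration bound *)

Section confidence_radius.
Context (R : realType) (p : nat) (a c q : R).
Hypotheses (a0 : 0 < a) (q0 : 0 < q) (c0 : 0 < c).

Lemma eps_radius_gt0 beta k : 0 < beta < c -> (0 < k)%N ->
  0 < eps_radius p a c q beta k.
Proof.
move=> /andP[b0 bc] k0; have k0R : 0 < k%:R :> R by rewrite ltr0n.
have l0 : 0 < ln (c / beta) by rewrite ln_gt0// ltr_pdivlMr// mul1r.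
by rewrite /eps_radius; case: ifP => _; apply: powR_gt0; rewrite divr_gt0// mulr_gt0.
Qed.

(** The test in [eps_radius] decides whether [ln (c / beta) / (q * k)] is at most 1. Positive powers
    preserve the comparison with 1, so [conc_bound] takes the matching branch and its exponent
    cancels the root. *)
Lemma conc_bound_eps_radius beta k : 0 < beta < c -> (0 < k)%N ->
  conc_bound p a c q (eps_radius p a c q beta k) k = beta.
Proof.
move=> /andP[b0 bc] k0; have k0R : 0 < k%:R :> R by rewrite ltr0n.
have l0 : 0 < ln (c / beta) by rewrite ln_gt0// ltr_pdivlMr// mul1r.
have t0 : 0 < ln (c / beta) / (q * k%:R) by rewrite divr_gt0// mulr_gt0.
have E : c * expR (- (q * k%:R * (ln (c / beta) / (q * k%:R)))) = beta.
  rewrite mulrC [q * _ * _]mulrC divfK; last by rewrite mulf_neq0// gt_eqF.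
  by rewrite expRN lnK ?posrE ?divr_gt0// invf_div divfK// gt_eqF.
have m0 : 0 < (maxn p 2)%:R :> R by rewrite ltr0n leq_max orbT.
rewrite /eps_radius /conc_bound ler_pdivrMr//.
case: (leP (ln (c / beta)) (k%:R * q)) => lk.
  have t1 : ln (c / beta) / (q * k%:R) <= 1.
    by rewrite ler_pdivrMr ?mulr_gt0// mul1r [q * _]mulrC.
  have -> : (ln (c / beta) / (q * k%:R)) `^ (maxn p 2)%:R^-1 <= 1.
    rewrite [leRHS](_ : 1 = 1 `^ (maxn p 2)%:R^-1); last by rewrite powR1.
    apply: ge0_ler_powR => //.
    - by rewrite nnegrE ltW.
    - by rewrite nnegrE.
  by rewrite -powRrM mulVf ?gt_eqF// powRr1 ?ltW.
have t1 : 1 < ln (c / beta) / (q * k%:R).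
  by rewrite ltr_pdivlMr ?mulr_gt0// mul1r [q * _]mulrC.
have /lt_geF -> : 1 < (ln (c / beta) / (q * k%:R)) `^ a^-1.
  rewrite [ltLHS](_ : 1 = 1 `^ a^-1); last by rewrite powR1.
  apply: gt0_ltr_powR => //.
  - by rewrite invr_gt0.
  - by rewrite nnegrE.
  - by rewrite nnegrE ltW.
by rewrite -powRrM mulVf ?gt_eqF// powRr1 ?ltW.
Qed.

End confidence_radius.

(** * Independent samples and Borel-Cantelli *)

Section sampling.
Context (R : realType) (d d' : measure_display).
Context (Om : measurableType d) (T : measurableType d').
Context (Pr : probability Om R).

Lemma iid_inj (P : probability T R) (I J : eqType) (g : I -> J)
    (h : J -> option I) (X : J -> Om -> T) :
  pcancel g h -> iid Pr P X -> iid Pr P (X \o g).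
Proof.
move=> gK [mX PX iX]; split => [i|i A mA|s A us mA] /=.
- exact: mX.
- exact: PX.
(* The sets are extended by [setT] outside the range of [g]. *)
have := iX (map g s) (fun j => if h j is Some i then A i else setT).
rewrite !big_map map_inj_uniq//; last exact: pcan_inj gK.
under eq_bigr do rewrite gK.
under [in X in _ = X]eq_bigr do rewrite gK.
by apply => // j; case: (h j).
Qed.

(** First Borel-Cantelli lemma. The sets [A k] need not be measurable, so it is run on measurable
    sets [F k] that cover their complements for [k >= N] and are empty before. *)
Lemma ae_eventually_of_summable (A : nat -> set Om) (b : nat -> R) (N : nat) :
  (forall k, 0 <= b k) -> cvgn (series b) ->
  (forall k, (N <= k)%N -> prob_ge Pr (A k) (1 - b k)) ->
  {ae Pr, forall w, \forall k \near \oo, A k w}.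
Proof.
move=> b0 cb hA.
have hF k : exists F : set Om, [/\ measurable F, (Pr F <= (b k)%:E)%E &
    (N <= k)%N -> ~` A k `<=` F].
  have [Nk|kN] := leqP N k; last first.
    by exists set0; split; rewrite // measure0 lee_fin.
  have [B [mB BA hB]] := hA k Nk; exists (~` B); split.
  - exact: measurableC.
  - rewrite probability_setC// leeBlDr ?fin_num_measure//.
    by rewrite addeC -leeBlDr// -EFinB.
  - by move=> _; exact: subsetC.
have [F FP] := choice hF.
have mF k : measurable (F k) by have [] := FP k.
exists (lim_sup_set F); split.
- by apply: bigcapT_measurable => n; exact: bigcup_measurable.
- apply: lim_sup_set_cvg0 => //.
  apply: le_lt_trans (_ : (\sum_(0 <= k <oo) (b k)%:E < +oo)%E).
    by apply: lee_nneseries => // k _; have [] := FP k.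
  rewrite (_ : (\sum_(0 <= k <oo) _)%E = (limn (series b))%:E) ?ltry//.
  rewrite -EFin_lim//; congr (limn _); apply/funext => n.
  by rewrite /series/= sumEFin.
- move=> w /= nA n _; apply: contrapT => wF; apply: nA.
  exists (maxn n N) => // k /=; rewrite geq_max => /andP[nk Nk].
  apply: contrapT => nAk; apply: wF; exists k => //.
  by have [_ _ /(_ Nk)] := FP k; exact.
Qed.

End sampling.

Lemma ae_empirical_ball (R : realType) (p : nat) (nrm : 'rV[R]_p -> R)
    (Xi : set 'rV[R]_p) (Xi0 : Xi !=set0) (P : probability (outcome Xi0) R)
    (a c q : R) (beta : nat -> R) d (Om : measurableType d)
    (Pr : probability Om R) (X : nat -> Om -> outcome Xi0) :
  0 < a -> 0 < c -> 0 < q -> concentration nrm P a c q ->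
  (forall k, (0 < k)%N -> 0 < beta k) ->
  cvgn (series (fun k => beta k.+1)) -> iid Pr P X ->
  {ae Pr, forall w, \forall k \near \oo,
    (wasserstein nrm P (empirical (X ^~ w) k)
       <= (eps_radius p a c q (beta k) k)%:E)%E}.
Proof.
move=> a0 c0 q0 conc b0 cb iX.
(* Terms of a convergent series tend to 0. Once [beta] is below [c], the logarithm is positive, and
   so is the radius. *)
have [N _ Nc] : \forall k \near \oo, beta k.+1 < c.
  exact: (cvgr_lt 0 (cvg_series_cvg_0 cb)).
(* Sizes are shifted by one, as the empirical distribution is meaningful for positive sizes only. *)
have : {ae Pr, forall w, \forall k \near \oo,
    (wasserstein nrm P (empirical (X ^~ w) k.+1)
       <= (eps_radius p a c q (beta k.+1) k.+1)%:E)%E}.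
  apply: (ae_eventually_of_summable (b := fun k => beta k.+1) (N := N)) => //.
    by move=> k; rewrite ltW// b0.
  move=> k Nk; have bc : 0 < beta k.+1 < c by rewrite b0//; exact: Nc.
  rewrite -{2}(conc_bound_eps_radius p a0 q0 c0 bc (ltn0Sn k)).
  apply: conc => //; first exact: eps_radius_gt0.
  exact: (iid_inj (@valK _ _ 'I_k.+1) iX).
apply: filterS => w [M _ Mw]; exists M.+1 => // -[//|k] /= Mk.
exact: Mw.
Qed.

Lemma iid_slice (R : realType) d d' (Om : measurableType d)
    (T : measurableType d') (Pr : probability Om R) (P : probability T R)
    (I J : eqType) (X : I * J -> Om -> T) (i : I) :
  iid Pr P X -> iid Pr P (fun j => X (i, j)).
Proof.
apply: (iid_inj (g := pair i) (h := fun ij => if ij.1 == i then Some ij.2 else None)).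
by move=> j /=; rewrite eqxx.
Qed.

(** * Extended-real limits and the excess of sets *)

Lemma ge0_cvge_to0 (R : realType) (h : nat -> \bar R) :
  (forall e : R, 0 < e -> \forall n \near \oo, (0 <= h n <= e%:E)%E) ->
  h n @[n --> \oo] --> 0%E.
Proof.
move=> hP; apply/fine_cvgP; split.
  apply: filterS (hP 1 ltr01) => n /andP[h0 h1].
  by rewrite ge0_fin_numE// (le_lt_trans h1) ?ltry.
apply/cvgrPdist_le => e e0; apply: filterS (hP e e0) => n /andP[h0 h1].
rewrite sub0r normrN/= ger0_norm ?fine_ge0//.
by rewrite -lee_fin fineK// ge0_fin_numE// (le_lt_trans h1) ?ltry.
Qed.

Section excess_theory.
Context (R : realType) (V : normedModType R).
Implicit Types A B : set V.
Local Open Scope ereal_scope.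

Lemma excess_le A B (e : R) :
  (forall x, A x -> exists2 y, B y & (`|x - y| <= e)%R) -> excess A B <= e%:E.
Proof.
move=> AB; apply: ge_ereal_sup => _ [x Ax <-].
have [y By xy] := AB x Ax; apply: ge_ereal_inf.
by exists `|x - y|%:E; [exists y|rewrite lee_fin].
Qed.

(** Non-emptiness of [A] matters: a supremum over the empty set is [-oo]. *)
Lemma excess_ge0 A B : A !=set0 -> 0 <= excess A B.
Proof.
move=> [x Ax]; apply: le_ereal_sup_tmp.
eexists; first by exists x.
by apply: le_ereal_inf_tmp => _ [y _ <-]; rewrite lee_fin.
Qed.

End excess_theory.

(** * Deterministic stability of cores under perturbed lower bounds *)

Section core_stability.
Context (R : realType) (N : nat) (uN : R).
Implicit Types (S : subcoalition N) (x y : 'rV[R]_N).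

(** Common form of both cores. The bounds are extended reals because worst-case expectations are
    suprema in [\bar R]. *)
Definition core_above (w : subcoalition N -> \bar R) : set 'rV[R]_N :=
  [set x : 'rV[R]_N | \sum_i x 0 i = uN /\ forall S, (w S <= (payoff x (sval S))%:E)%E].

Lemma payoff_convex (t : R) x y (S : {set 'I_N}) :
  payoff ((1 - t) *: x + t *: y) S = (1 - t) * payoff x S + t * payoff y S.
Proof.
rewrite /payoff !mulr_sumr -big_split/=.
by apply: eq_bigr => i _; rewrite !mxE.
Qed.

Lemma sum_coord_convex (t : R) x y :
  \sum_i ((1 - t) *: x + t *: y) 0 i = (1 - t) * \sum_i x 0 i + t * \sum_i y 0 i.
Proof.
by rewrite !mulr_sumr -big_split/=; apply: eq_bigr => i _; rewrite !mxE.
Qed.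

Lemma setC1_proper (i : 'I_N) : (~: [set i] \proper [set: 'I_N])%SET.
Proof.
by rewrite properE finset.subsetT; apply/subsetPn; exists i; rewrite !inE// eqxx.
Qed.

Definition all_but (i : 'I_N) : subcoalition N :=
  exist (fun S : {set 'I_N} => is_true (S \proper [set: 'I_N]%SET)) _ (setC1_proper i).

(* Each coordinate is bounded above through the complement of the agent, and
   below because the coordinates add up to [uN]. *)
Lemma core_above_bounded (v : subcoalition N -> R) :
  exists2 C, 0 <= C & forall x, core_above (EFin \o v) x -> `|x| <= C.
Proof.
pose b i := uN - v (all_but i).
exists (\sum_i `|b i| + `|uN|); first by rewrite addr_ge0// sumr_ge0.
move=> x [xN xv].
have xb i : x 0 i <= b i.
  have := xv (all_but i); rewrite /= lee_fin /b -xN.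
  have -> : payoff x (sval (all_but i)) = \sum_(j | j != i) x 0 j.
    by apply: eq_bigl => j; rewrite !inE.
  rewrite [in X in _ -> X](bigD1 i)//=.
  by lra.
have xb' i : x 0 i <= `|b i| := le_trans (xb i) (ler_norm _).
rewrite [leLHS]/Num.norm/= mx_normrE; apply/bigmax_leP; split=> [|[j i] _/=].
  by rewrite addr_ge0// sumr_ge0.
rewrite ord1 ler_norml; apply/andP; split.
- have : \sum_(k | k != i) x 0 k <= \sum_(k | k != i) `|b k| by exact: ler_sum.
  have := xN; rewrite (bigD1 i)//= [X in - (X + _)](bigD1 i)//=.
  have := normr_ge0 (b i); have := ler_norm (- uN); rewrite normrN.
  by lra.
- rewrite (bigD1 i)//=.
  have : 0 <= \sum_(k | k != i) `|b k| by apply: sumr_ge0.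
  by have := xb' i; have := normr_ge0 uN; lra.
Qed.

Context (v : subcoalition N -> R) (w : subcoalition N -> nat -> \bar R).
Hypothesis vw : forall S, \forall k \near \oo, ((v S)%:E <= w S k)%E.
Hypothesis wv : forall S (e : R), 0 < e ->
  \forall k \near \oo, (w S k <= (v S + e)%:E)%E.
Hypothesis w_feasible : forall K : subcoalition N -> nat,
  (forall S, (0 < K S)%N) -> core_above (fun S => w S (K S)) !=set0.

(* There is no Slater condition: a constraint S that [y] does not satisfy
   strictly is one on which the sequence [w S] is eventually equal to [v S]. *)
Lemma core_above_anchor : exists2 y, core_above (EFin \o v) y &
  forall S (t : R), 0 < t -> \forall k \near \oo,
    (w S k <= (v S + t * (payoff y (sval S) - v S))%:E)%E.
Proof.
(* For each [S], choose a size at which [w S] strictly exceeds [v S], if arbitrarily late ones can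
   be found; otherwise [w S] is at most [v S] from some size on. *)
have kP S : exists k, [/\ (0 < k)%N, ((v S)%:E <= w S k)%E &
    ((v S)%:E < w S k)%E \/ \forall k' \near \oo, (w S k' <= (v S)%:E)%E].
  have [k0 _ k0P] := vw S.
  have [[k [k0k k_gt0 vk]]|nk] := pselect (exists k,
    [/\ (k0 <= k)%N, (0 < k)%N & ((v S)%:E < w S k)%E]).
    by exists k; split => //; [exact: k0P|left].
  exists k0.+1; split => //; first exact: (k0P _ (leqnSn _)).
  right; exists k0.+1 => // k /= k0k; rewrite leNgt; apply/negP => vk; apply: nk.
  by exists k; split => //; [exact: ltnW|exact: leq_trans k0k].
have [K KP] := choice kP.
(* Feasibility is used at the sizes just chosen, separately for each [S], so that one [y] meets all
   these bounds. *)
have [|y [yN yK]] := w_feasible (K := K); first by move=> S; have [] := KP S.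
exists y; first by split=> // S; apply: le_trans (yK S); have [] := KP S.
(* In the first case [y] has positive slack at [S], which absorbs the vanishing error of [w S]; in
   the second no slack is required. *)
move=> S t t0; have [_ vK [vltK|wlev]] := KP S.
  apply: wv; rewrite mulr_gt0// subr_gt0 -lte_fin.
  exact: lt_le_trans (yK S).
apply: filterS wlev => k /le_trans; apply; rewrite lee_fin lerDl.
by rewrite mulr_ge0 ?(ltW t0)// subr_ge0 -lee_fin (le_trans vK).
Qed.

(** One excess is controlled by inclusion of the perturbed core in the limit core, the other by
    contracting the limit core towards the anchor [y], which costs at most [t * (C + |y|)]. *)
Lemma hausdorff_core_above_cvg (K : nat -> subcoalition N -> nat) :
  (forall n S, (0 < K n S)%N) -> (forall S, K n S @[n --> \oo] --> \oo) ->
  hausdorff_dist (core_above (fun S => w S (K n S))) (core_above (EFin \o v))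
    @[n --> \oo] --> 0%E.
Proof.
move=> K0 Koo; have [y [yN yv] yP] := core_above_anchor.
have [C C0 CP] := core_above_bounded v.
apply: ge0_cvge_to0 => e e0.
have D0 : 0 < C + `|y| + 1 by rewrite ltr_wpDl// addr_ge0.
(* At most 1, to form convex combinations, and small enough that the displacement stays below
   [e]. *)
pose t := Num.min 1 (e / (C + `|y| + 1)).
have t0 : 0 < t by rewrite lt_min ltr01 divr_gt0.
have t1 : t <= 1 by rewrite ge_min lexx.
have te : t * (C + `|y|) <= e.
  apply: (@le_trans _ _ (e / (C + `|y| + 1) * (C + `|y|))).
    by rewrite ler_wpM2r ?addr_ge0// ge_min lexx orbT.
  by rewrite mulrAC ler_pdivrMr// ler_pM2l// lerDl.
(* There are finitely many subcoalitions, so eventual bounds hold for all of them at once. *)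
have near_vw : \forall n \near \oo, forall S, ((v S)%:E <= w S (K n S))%E.
  by apply: filter_forall => S; exact: (Koo S) (vw S).
have near_wt : \forall n \near \oo, forall S,
    (w S (K n S) <= (v S + t * (payoff y (sval S) - v S))%:E)%E.
  by apply: filter_forall => S; exact: (Koo S) (yP S t t0).
near=> n.
have n1 : forall S, ((v S)%:E <= w S (K n S))%E by near: n.
have n2 : forall S, (w S (K n S) <= (v S + t * (payoff y (sval S) - v S))%:E)%E.
  by near: n.
rewrite /hausdorff_dist; apply/andP; split.
  by rewrite le_max; apply/orP; left; apply: excess_ge0; exact: w_feasible.
rewrite ge_max; apply/andP; split.
  apply: excess_le => x [xN xw]; exists x; last by rewrite subrr normr0 ltW.
  by split => // S; apply: le_trans (n1 S) (xw S).
apply: excess_le => x Ex; have [xN xv] := Ex.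
(* Its payoff on [S] is at least [(1 - t) * v S + t * payoff y S], the bound that [w S] obeys by the
   choice of [y]. *)
exists ((1 - t) *: x + t *: y).
  split; first by rewrite sum_coord_convex xN yN; ring.
  move=> S; apply: le_trans (n2 S) _; rewrite lee_fin payoff_convex.
  have := xv S; rewrite /= lee_fin => /(ler_wpM2l (_ : 0 <= 1 - t)).
  by rewrite subr_ge0 => /(_ t1); lra.
rewrite (_ : x - _ = t *: (x - y)); last first.
  by apply/rowP => j; rewrite !mxE; ring.
rewrite normrZ gtr0_norm//; apply: le_trans te; rewrite ler_wpM2l ?(ltW t0)//.
by rewrite (le_trans (ler_normB _ _))// lerD2r CP.
Unshelve. all: by end_near.
Qed.

End core_stability.

(** * Worst-case expectations over Wasserstein balls *)

Section robust_expectation.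
Context (R : realType) (p : nat) (nrm : 'rV[R]_p -> R).
Hypothesis nrm_norm : is_norm nrm.
Context (Xi : set 'rV[R]_p) (Xi0 : Xi !=set0) (P : probability (outcome Xi0) R).
Local Notation T := (outcome Xi0).

(** For [s >= 0] and [a > 1], [s <= 1 + s^a <= exp(s^a)]. *)
Lemma exp_moment_finite_first_moment (a : R) : 1 < a ->
  (\int[P]_x (expR (onorm nrm x `^ a))%:E < +oo)%E -> finite_first_moment nrm P.
Proof.
move=> a1; apply: le_lt_trans; apply: ge0_le_integral => //.
- by move=> x _; rewrite lee_fin onorm_ge0.
- by apply/measurable_EFinP; exact: measurable_onorm.
- apply/measurable_EFinP; apply: measurableT_comp => //.
  exact: (measurableT_comp (measurable_powR a) (measurable_onorm nrm_norm)).
- move=> x _; rewrite lee_fin.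
  have x0 : 0 <= onorm nrm x by exact: onorm_ge0.
  apply: le_trans (expR_ge1Dx _).
  have [x1|/ltW x1] := leP (onorm nrm x) 1.
    by rewrite (le_trans x1)// lerDl powR_ge0.
  have := ler_powR x1 (ltW a1); rewrite powRr1//; lra.
Qed.

Section lipschitz.
Context (f : T -> R) (L : R).
Hypothesis L0 : 0 <= L.
Hypothesis fL : forall x y, `|f x - f y| <= L * odist nrm x y.
Hypothesis P1 : finite_first_moment nrm P.
Local Open Scope ereal_scope.

Lemma lipschitz_integrable : P.-integrable setT (EFin \o f).
Proof.
pose x0 : T := point.
pose C : R := (`|f x0| + L * onorm nrm x0)%R.
have C0 : (0 <= C)%R by rewrite addr_ge0// mulr_ge0// onorm_ge0.
have Oi : P.-integrable setT (fun x => (onorm nrm x)%:E).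
  apply/integrableP; split; first exact/measurable_EFinP/measurable_onorm.
  apply: le_lt_trans P1; rewrite le_eqVlt; apply/orP; left; apply/eqP.
  by apply: eq_integral => x _; rewrite gee0_abs// lee_fin onorm_ge0.
apply: (@le_integrable _ _ _ P setT measurableT _
  (fun x => C%:E + L%:E * (onorm nrm x)%:E)).
- apply/measurable_EFinP; exact: lipschitz_measurable fL.
- move=> x _; rewrite -EFinM -EFinD !abse_EFin lee_fin.
  have h0 : (0 <= onorm nrm x)%R by exact: onorm_ge0.
  rewrite [leRHS]ger0_norm; last by rewrite addr_ge0// mulr_ge0.
  have h1 := fL x x0.
  have h2 : (odist nrm x x0 <= onorm nrm x + onorm nrm x0)%R.
    rewrite /odist /onorm -(is_normN nrm_norm (set_val x0)).
    exact: is_norm_triangle.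
  have h3 := ler_wpM2l L0 h2; have h4 := ler_normD (f x - f x0)%R (f x0).
  by move: h4; rewrite subrK /C; lra.
- apply: integrableD => //; last exact: integrableZl.
  by apply: finite_measure_integrable_cst.
Qed.

Lemma expectation_fin_num : 'E_P[f] \is a fin_num.
Proof.
by rewrite unlock; apply: integrable_fin_num => //; exact: lipschitz_integrable.
Qed.

Context (mu : {measure set T -> \bar R}) (eps : R).
Hypothesis Pmu : wasserstein nrm P mu <= eps%:E.

(** [P] itself belongs to the ball. *)
Lemma expectation_le_robust :
  'E_P[f] <= ereal_sup [set 'E_Q[f] | Q in wasserstein_ball nrm mu eps].
Proof.
by apply: ereal_sup_ubound; exists P => //; split => //; rewrite wasserstein_sym.
Qed.

(** The factor 2 comes from passing from [Q] to the center [mu] and from [mu] to [P], each at cost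
    [L * eps]. Integrability travels the other way, from [P] to [mu] to [Q]. *)
Lemma robust_le_expectation :
  ereal_sup [set 'E_Q[f] | Q in wasserstein_ball nrm mu eps]
    <= 'E_P[f] + (2 * L * eps)%:E.
Proof.
have muP : wasserstein nrm mu P <= eps%:E by rewrite wasserstein_sym.
have [muf hmu] := wasserstein_lipschitz nrm_norm L0 fL muP lipschitz_integrable.
apply: ge_ereal_sup => _ [Q [_ muQ] <-].
have Qmu : wasserstein nrm Q mu <= eps%:E by rewrite wasserstein_sym.
have [Qf hQ] := wasserstein_lipschitz nrm_norm L0 fL Qmu muf.
rewrite unlock; move: hmu hQ.
have /integrable_fin_num := muf; have /integrable_fin_num := Qf.
have /integrable_fin_num := lipschitz_integrable.
move=> /(_ measurableT)/fineK /= <- /(_ measurableT)/fineK /= <-.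
move=> /(_ measurableT)/fineK /= <-.
rewrite -!EFinB !abse_EFin -EFinD !lee_fin !ler_norml => /andP[_ h1] /andP[_ h2].
by lra.
Qed.

End lipschitz.
End robust_expectation.

(** * Almost sure convergence of the robust cores *)

Theorem theorem3 (R : realType) (p N : nat)
  (nrm : 'rV[R]_p -> R) (nrm_norm : is_norm nrm)
  (Xi : set 'rV[R]_p) (Xi0 : Xi !=set0)
  (P : probability (outcome Xi0) R)
  (uN : R) (u : subcoalition N -> outcome Xi0 -> R)
  (a c q : R)
  (beta : subcoalition N -> nat -> R)
  (d : measure_display) (Om : measurableType d) (Pr : probability Om R)
  (xi : subcoalition N * nat -> Om -> outcome Xi0) :
  p != 2%N ->
  1 < a ->
  (\int[P]_x (expR (onorm nrm x `^ a))%:E < +oo)%E ->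
  (forall S : subcoalition N, exists2 L : R, 0 <= L &
     forall x y, `|u S x - u S y| <= L * odist nrm x y) ->
  0 < c -> 0 < q -> concentration nrm P a c q ->
  (forall (S : subcoalition N) k, (0 < k)%N -> 0 < beta S k < 1) ->
  (forall S : subcoalition N, cvgn (series (fun k => beta S k.+1))) ->
  (forall S : subcoalition N, eps_radius p a c q (beta S k) k @[k --> \oo] --> 0) ->
  iid Pr P xi ->
  (forall w (K : subcoalition N -> nat), (forall S : subcoalition N, (0 < K S)%N) ->
     DR_core uN u (wasserstein_ambiguity nrm a c q beta (xi ^~ w) K) !=set0) ->
  {ae Pr, forall w,
     forall K : nat -> subcoalition N -> nat,
       (forall n S, (0 < K n S)%N) ->
       (forall S : subcoalition N, K n S @[n --> \oo] --> \oo) ->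
       hausdorff_dist
         (DR_core uN u (wasserstein_ambiguity nrm a c q beta (xi ^~ w) (K n)))
         (E_core uN u P) @[n --> \oo] --> 0%E}.
Proof.
move=> _ a1 expP lip c0 q0 conc b01 bcvg reps iX feas.
have a0 : 0 < a by apply: lt_trans a1.
have P1 := exp_moment_finite_first_moment nrm_norm a1 expP.
(* A finite intersection of almost sure events, chosen before [K]: one null set serves all sequences
   of sample sizes. *)
have good : {ae Pr, forall w, forall S, \forall k \near \oo,
    (wasserstein nrm P (empirical (fun i => xi (S, i) w) k)
       <= (eps_radius p a c q (beta S k) k)%:E)%E}.
  apply: filter_forall => S.
  apply: (@ae_empirical_ball _ _ _ _ _ P a c q (beta S) _ _ _
    (fun i => xi (S, i))) => //; last exact: iid_slice.
  by move=> k k0; have /andP[] := b01 S k k0.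
(* From here on the multi-sample is fixed and the argument is deterministic. *)
apply: filterS good => w near_ball K K0 Koo.
pose v S := fine ('E_P[u S])%E.
have vE S : (v S)%:E = ('E_P[u S])%E.
  have [L L0 uL] := lip S.
  by rewrite fineK// (expectation_fin_num nrm_norm L0 uL P1).
pose ball S k := wasserstein_ball nrm (empirical (fun i => xi (S, i) w) k)
  (eps_radius p a c q (beta S k) k).
pose r S k := ereal_sup [set ('E_Q[u S])%E | Q in ball S k].
have -> : E_core uN u P = core_above uN (EFin \o v).
  by apply/seteqP; split => x [xN xS]; split => // S; have := xS S; rewrite /= vE.
apply: (hausdorff_core_above_cvg (w := r)) => //.
- move=> S; apply: filterS (near_ball S) => k kP; rewrite vE.
  exact: expectation_le_robust.
- move=> S e e0; have [L L0 uL] := lip S.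
  have L1 : 0 < 2 * L + 1 by rewrite ltr_wpDl// mulr_ge0.
  (* Makes the error [2 * L * eps] at most [e], also when [L = 0]. *)
  have reps_small : \forall k \near \oo, eps_radius p a c q (beta S k) k <= e / (2 * L + 1).
    by apply: cvgr_le (reps S) _ _; rewrite divr_gt0.
  apply: filterS2 reps_small (near_ball S) => k ke kP.
  have := robust_le_expectation nrm_norm L0 uL P1 kP.
  move=> /le_trans; apply; rewrite -vE -EFinD lee_fin lerD2l.
  apply: (@le_trans _ _ (2 * L * (e / (2 * L + 1)))).
    by rewrite ler_wpM2l// mulr_ge0.
  by rewrite mulrA ler_pdivrMr// mulrC ler_pM2l// lerDl.
- by move=> K' K'0; exact: feas.
Qed.
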